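(* Let $G$ be a group generated by a finite set $S$ and let $E\subset G$ be a subset. Suppose there is a finite subset $F\subset G$ such that for every $g\in G$ there is an $f\in F$ with $gf\in E$. Then there exists a constant $c\in(0,1)$ (depending on $S$, with $G$, $E$, $F$ fixed) such that $$\frac{\sharp\,(S^{\le n}\cap E)}{\sharp\, S^{\le n}}>c$$ for all sufficiently large $n$.
   Context: $S^{\le n}$ is the set of elements of $G$ that can be written as a product of at most $n$ letters in $S\cup S^{-1}$; $\sharp$ denotes cardinality. *)

(* Defs.v *)
From mathcomp Require Import all_boot all_order all_algebra.
From mathcomp Require Import finmap.
From mathcomp Require Import boolp classical_sets functions cardinality reals.

Set Implicit Arguments.
Unset Strict Implicit.
Unset Printing Implicit Defensive.

Local Open Scope classical_set_scope.
Local Open Scope group_scope.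

Definition generates (G : groupType) (S : set G) : Prop :=
  smallest (fun H : set G => group_closed (mem H)) S = setT.

Definition letters (G : groupType) (S : set G) : set G :=
  S `|` [set x^-1 | x in S].

(* The empty word is allowed, so 1 belongs to [word_ball S n] for every n. *)
Definition word_ball (G : groupType) (S : set G) (n : nat) : set G :=
  [set g | exists w : seq G,
     [/\ (size w <= n)%N, forall x, x \in w -> letters S x
       & g = \prod_(x <- w) x]].

(* [fset_set A] is empty when [A] is infinite; by the next lemma this does not
   affect cardinals of balls of finite sets. *)
Definition ncard (G : groupType) (A : set G) : nat := #|` fset_set A|.

Lemma finite_word_ball (G : groupType) (S : set G) (n : nat) :
  finite_set S -> finite_set (word_ball S n).
Proof.
move=> finS; have finL : finite_set (letters S).
  by rewrite finite_setU; split=> //; apply: finite_image.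
elim: n => [|n IHn].
  apply: (@sub_finite_set _ _ [set 1]); last exact: finite_set1.
  move=> g [w [w0 _ ->]] /=.
  by move: w0; rewrite leqn0 => /nilP ->; rewrite big_nil.
apply: (@sub_finite_set _ _
  ([set 1] `|` [set x * y | x in letters S & y in word_ball S n])); last first.
  rewrite finite_setU; split; first exact: finite_set1.
  exact: finite_image2.
move=> g [[|x w] [sw Lw ->]]; first by left; rewrite big_nil.
right; rewrite big_cons; exists x; first by apply: Lw; rewrite mem_head.
exists (\prod_(y <- w) y) => //; exists w; split=> // y yw.
by apply: Lw; rewrite inE yw orbT.
Qed.

(* Main.v *)
Require Import Defs.
From mathcomp Require Import all_boot all_order all_algebra.
From mathcomp Require Import finmap.
From mathcomp Require Import boolp classical_sets functions cardinality reals.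

(** Choose k with F inside the ball B_k.  For n >= k, right translation by
    elements of F sends every point of B_(n-k) into the intersection of E and
    B_n, so |B_(n-k)| <= |B_n & E| |F|; and B_n = B_(n-k) B_k gives
    |B_n| <= |B_(n-k)| |B_k|.  Hence the density of E in B_n is at least
    1 / (|F| |B_k|). *)

Import GRing.Theory Num.Theory.

Local Open Scope classical_set_scope.
Local Open Scope ring_scope.

(** The list of all [h x y] has length [ncard B * ncard C] and contains the duplicate-free
    enumeration of [A]. The operation [h] is left general because both the product and [x * f^-1]
    are needed. *)
Lemma leq_ncard_image2 (G : groupType) (h : G -> G -> G) (A B C : set G) :
  finite_set B -> finite_set C ->
  A `<=` [set h x y | x in B & y in C] -> (ncard A <= ncard B * ncard C)%N.
Proof.
move=> finB finC sAh.
have finA : finite_set A := sub_finite_set sAh (finite_image2 h finB finC).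
rewrite /ncard -(size_allpairs h) uniq_leq_size ?fset_uniq// => g.
rewrite in_fset_set// inE => /sAh[x Bx [y Cy <-]].
by apply: allpairs_f; rewrite in_fset_set// inE.
Qed.

Lemma ncard_gt0 (G : groupType) (A : set G) (g : G) :
  finite_set A -> A g -> (0 < ncard A)%N.
Proof.
move=> finA Ag; rewrite /ncard cardfs_gt0; apply/fset0Pn; exists g.
by rewrite in_fset_set// inE.
Qed.

Section WordBall.
Variables (G : groupType) (S : set G).

Lemma word_ball1 n : word_ball S n 1%g.
Proof. by exists [::]; split; rewrite ?big_nil. Qed.

Lemma sub_word_ball m n : (m <= n)%N -> word_ball S m `<=` word_ball S n.
Proof. by move=> mn g [w [/leq_trans wm Lw ->]]; exists w; split=> //; apply: wm. Qed.

Lemma word_ballM m n x y :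
  word_ball S m x -> word_ball S n y -> word_ball S (m + n) (x * y)%g.
Proof.
move=> [v [vm Lv ->]] [w [wn Lw ->]]; exists (v ++ w); split.
- by rewrite size_cat leq_add.
- by move=> z; rewrite mem_cat => /orP[/Lv|/Lw].
- by rewrite big_cat.
Qed.

Lemma lettersV x : letters S x -> letters S x^-1%g.
Proof.
by move=> [Sx|[y Sy <-]]; [right; exists x | left; rewrite invgK].
Qed.

Lemma word_ballV n x : word_ball S n x -> word_ball S n x^-1%g.
Proof.
move=> [w [wn Lw ->]]; exists [seq y^-1%g | y <- rev w]; split.
- by rewrite size_map size_rev.
- by move=> _ /mapP[y + ->]; rewrite mem_rev => /Lw/lettersV.
- by rewrite big_map prodgV revK.
Qed.

(** Cut the word after its first [m] letters; if it is shorter, the second factor is the empty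
    product. *)
Lemma word_ball_split m n :
  word_ball S (m + n) `<=`
  [set (x * y)%g | x in word_ball S m & y in word_ball S n].
Proof.
move=> _ [w [wmn Lw ->]]; exists (\prod_(x <- take m w) x)%g.
  by exists (take m w); split=> // [|x /mem_take/Lw//]; rewrite size_take_min geq_minl.
exists (\prod_(x <- drop m w) x)%g; last by rewrite -big_cat cat_take_drop.
by exists (drop m w); split=> // [|x /mem_drop/Lw//]; rewrite size_drop leq_subLR.
Qed.

Lemma bigcup_word_ball : generates S -> \bigcup_n word_ball S n = setT.
Proof.
move=> genS; apply/seteqP; split=> // g _.
have : smallest (fun H : set G => group_closed (mem H)) S g by rewrite genS.
(* The union of the balls is itself a subgroup containing [S]: closure is checked on [1] and on
   quotients [x * y^-1], and a generator is a word of length one. *)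
apply: smallest_sub => [|s Ss].
  split=> [|x y]; first by rewrite inE; exists 0%N => //; apply: word_ball1.
  rewrite !inE => -[m _ Bx] [n _ By]; exists (m + n)%N => //.
  exact: word_ballM Bx (word_ballV _ _ By).
exists 1%N => //; exists [:: s]; split=> // [x|]; last by rewrite big_seq1.
by rewrite inE => /eqP ->; left.
Qed.

Lemma finite_sub_word_ball (F : set G) :
  generates S -> finite_set F -> exists k, F `<=` word_ball S k.
Proof.
move=> /bigcup_word_ball cupB /finite_seqP[s ->].
have /choice[l Bl] (g : G) : exists n, word_ball S n g.
  by have [n _ Bg] : (\bigcup_n word_ball S n) g; [rewrite cupB | exists n].
(* Balls increase with the radius, so the largest of the finitely many radii [l f] serves all of
   [F]. *)
exists (\max_(f <- s) l f)%N => f /= sf.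
exact: sub_word_ball (leq_bigmax_seq _ sf isT) _ (Bl f).
Qed.

Lemma leq_ncard_ball_syndetic (E F : set G) k m :
  finite_set S -> finite_set F ->
  (forall g : G, exists2 f : G, F f & E (g * f)%g) -> F `<=` word_ball S k ->
  (ncard (word_ball S (m + k)) <=
   ncard (word_ball S (m + k) `&` E) * (ncard F * ncard (word_ball S k)))%N.
Proof.
move=> finS finF FE FB; have finB n := finite_word_ball n finS.
rewrite mulnA; apply: leq_trans (leq_ncard_image2 _ _ _ _ _ (finB m) (finB k)
  (word_ball_split m k)) _.
(* The common factor, the size of the ball of radius [k], cancels. What remains is to cover the ball
   of radius [m], by writing [g] as [(g * f) * f^-1] with [g * f] in [E]. *)
rewrite leq_mul2r; apply/orP; right; apply: (leq_ncard_image2 _ (fun x f => x * f^-1)%g) => //.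
  exact: finite_setIl.
move=> g Bg; have [f Ff Egf] := FE g; exists (g * f)%g.
  by split=> //; apply: word_ballM Bg (FB _ Ff).
by exists f => //; rewrite mulgK.
Qed.

End WordBall.

Theorem lemma1p7 (R : realType) (G : groupType) (S E F : set G)
    (finS : finite_set S) (genS : generates S)
    (finF : finite_set F)
    (FE : forall g : G, exists2 f : G, F f & E (g * f)%g) :
  exists c : R, 0 < c < 1 /\
    exists N : nat, forall n : nat, (N <= n)%N ->
      (ncard (word_ball S n `&` E))%:R / (ncard (word_ball S n))%:R > c.
Proof.
have [k FB] := finite_sub_word_ball _ _ _ genS finF.
pose M := (ncard F * ncard (word_ball S k))%N.
have B_gt0 n : (0 < ncard (word_ball S n))%N.
  exact: ncard_gt0 (finite_word_ball n finS) (word_ball1 _ _ n).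
have M_gt0 : (0 < M)%N.
  by have [f Ff _] := FE 1%g; rewrite muln_gt0 (ncard_gt0 _ _ f)// B_gt0.
(* Taking [M.+1] instead of [M] makes the density bound strict and keeps the constant below 1 even
   when [M = 1]. *)
exists M.+1%:R^-1; split; first by rewrite invr_gt0 ltr0n invf_lt1 ?ltr0n ?ltr1n.
exists k => n kn.
have := leq_ncard_ball_syndetic _ _ _ _ k (n - k) finS finF FE FB.
rewrite subnK// -/M; set e := ncard (_ `&` _) => le_eM.
(* Positivity of [e] is what makes [e * M < e * M.+1] strict. *)
have e_gt0 : (0 < e)%N.
  by have := leq_trans (B_gt0 n) le_eM; rewrite muln_gt0 => /andP[].
rewrite ltr_pdivlMr ?ltr0n// mulrC ltr_pdivrMr ?ltr0n// -natrM ltr_nat.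
by rewrite (leq_ltn_trans le_eM)// ltn_pmul2l.
Qed.
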